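(* Let $L,M,N$ be positive integers. The following statements are equivalent: 1. There exists $g:=\{g_l\}_{l\in\mathbb{N}_L}\subset\ell^2(\mathbb{Z}\times\mathbb{Z},\mathbb{H})$ such that $\mathcal{G}(g,L,M,N)$ is an orthonormal basis for $\ell^2(\mathbb{Z}\times\mathbb{Z},\mathbb{H})$. 2. $N^2=LM^2$.
   Context: $\mathbb{H}$ is the algebra of real quaternions with imaginary units $i,j,ij$. For a positive integer $K$, $\mathbb{N}_K:=\{0,1,\dots,K-1\}$. $\ell^2(\mathbb{Z}\times\mathbb{Z},\mathbb{H})$ is the right quaternionic Hilbert space of functions $f:\mathbb{Z}^2\to\mathbb{H}$ with $\sum_{k\in\mathbb{Z}^2}|f(k)|^2<\infty$, with inner product $\langle f,g\rangle=\sum_{k\in\mathbb{Z}^2}\overline{f(k)}\,g(k)$ and scalars acting on the right. For $n\in\mathbb{Z}^2$, $(T_{nN}f)(k)=f(k-nN)$ where $nN=(n_1N,n_2N)$. For $m=(m_1,m_2)\in\mathbb{N}_M^2$, $(E_{\frac mM}f)(k)=e^{2\pi i\frac{m_1}{M}k_1}f(k)e^{2\pi j\frac{m_2}{M}k_2}$, $k=(k_1,k_2)\in\mathbb{Z}^2$. The Gabor system is the indexed family $\mathcal{G}(g,L,M,N):=\{E_{\frac mM}T_{nN}g_l\}_{l\in\mathbb{N}_L,\,m\in\mathbb{N}_M^2,\,n\in\mathbb{Z}^2}$. *)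

(* Defs.v *)
(* MathComp / MathComp-Analysis world; the reals are an arbitrary R : realType. *)
From HB Require Import structures.
From mathcomp Require Import all_boot all_order all_algebra.
From mathcomp Require Import ring.
From mathcomp Require Import all_classical all_reals all_analysis.

Set Implicit Arguments.
Unset Strict Implicit.
Unset Printing Implicit Defensive.

Import Order.TTheory GRing.Theory Num.Theory.

Local Open Scope ring_scope.

(* Quat a b c d is a + b i + c j + d ij. *)
Record quat (R : realType) := Quat { qre : R; qimi : R; qimj : R; qimk : R }.

Section QuaternionRing.
Variable R : realType.
Implicit Types x y z : quat R.

Definition quat_tuple x := (qre x, qimi x, qimj x, qimk x).
Definition tuple_quat (t : R * R * R * R) :=
  Quat t.1.1.1 t.1.1.2 t.1.2 t.2.

Lemma quat_tupleK : cancel quat_tuple tuple_quat.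
Proof. by case. Qed.

HB.instance Definition _ := Choice.copy (quat R) (can_type quat_tupleK).

Definition qadd x y :=
  Quat (qre x + qre y) (qimi x + qimi y) (qimj x + qimj y) (qimk x + qimk y).

Definition qopp x := Quat (- qre x) (- qimi x) (- qimj x) (- qimk x).

Definition qmul x y :=
  Quat
    (qre x * qre y - qimi x * qimi y - qimj x * qimj y - qimk x * qimk y)
    (qre x * qimi y + qimi x * qre y + qimj x * qimk y - qimk x * qimj y)
    (qre x * qimj y - qimi x * qimk y + qimj x * qre y + qimk x * qimi y)
    (qre x * qimk y + qimi x * qimj y - qimj x * qimi y + qimk x * qre y).

Lemma qaddA : associative qadd.
Proof. by move=> x y z; congr Quat; rewrite /= addrA. Qed.
Lemma qaddC : commutative qadd.
Proof. by move=> x y; congr Quat; rewrite /= addrC. Qed.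
Lemma qadd0 : left_id (Quat 0 0 0 0) qadd.
Proof. by case=> a b c d; congr Quat; rewrite /= add0r. Qed.
Lemma qaddN : left_inverse (Quat 0 0 0 0) qopp qadd.
Proof. by move=> x; congr Quat; rewrite /= addNr. Qed.

HB.instance Definition _ := GRing.isZmodule.Build (quat R) qaddA qaddC qadd0 qaddN.

Lemma qmulA : associative qmul.
Proof. by move=> x y z; congr Quat => /=; ring. Qed.
Lemma qmul1 : left_id (Quat 1 0 0 0) qmul.
Proof. by case=> a b c d; congr Quat => /=; ring. Qed.
Lemma qmulr1 : right_id (Quat 1 0 0 0) qmul.
Proof. by case=> a b c d; congr Quat => /=; ring. Qed.
Lemma qmulDl : left_distributive qmul +%R.
Proof. by move=> x y z; congr Quat => /=; ring. Qed.
Lemma qmulDr : right_distributive qmul +%R.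
Proof. by move=> x y z; congr Quat => /=; ring. Qed.
Lemma q1_neq0 : Quat 1 0 0 0 != 0 :> quat R.
Proof. by apply/eqP => -[] /eqP; rewrite oner_eq0. Qed.

HB.instance Definition _ := GRing.Zmodule_isNzRing.Build (quat R)
  qmulA qmul1 qmulr1 qmulDl qmulDr q1_neq0.

Definition qreal (a : R) : quat R := Quat a 0 0 0.
Definition qi : quat R := Quat 0 1 0 0.
Definition qj : quat R := Quat 0 0 1 0.

Definition qconj x := Quat (qre x) (- qimi x) (- qimj x) (- qimk x).

Definition qabs x : R :=
  Num.sqrt (qre x ^+ 2 + qimi x ^+ 2 + qimj x ^+ 2 + qimk x ^+ 2).

(* e^(u t) for a unit u with u * u = -1. *)
Definition qexp (u : quat R) (t : R) : quat R := qreal (cos t) + u * qreal (sin t).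

End QuaternionRing.

Section QuaternionL2.
Variable R : realType.
Implicit Types f g : int * int -> quat R.

Definition l2 f : Prop :=
  (\esum_(k in [set: int * int]) (qabs (f k) ^+ 2)%:E < +oo)%E.

(* The unconditional sum of an absolutely summable real family. *)
Definition rsum (u : int * int -> R) : R :=
  fine (\esum_(k in [set: int * int]) ((EFin \o u)^\+)%E k
      - \esum_(k in [set: int * int]) ((EFin \o u)^\-)%E k)%E.

Definition qsum (u : int * int -> quat R) : quat R :=
  Quat (rsum (fun k => qre (u k))) (rsum (fun k => qimi (u k)))
       (rsum (fun k => qimj (u k))) (rsum (fun k => qimk (u k))).

(* Absolutely convergent when f and g are both in l2. *)
Definition inner f g : quat R := qsum (fun k => qconj (f k) * g k).

Definition l2norm f : R := Num.sqrt (qre (inner f f)).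

Definition right_comb (I : Type) (e : I -> int * int -> quat R)
    (s : seq (I * quat R)) : int * int -> quat R :=
  fun k => \sum_(p <- s) e p.1 k * p.2.

(* An orthonormal family of vectors of l2, injectively indexed by
   orthonormality, whose right quaternionic linear span is dense in l2. *)
Definition orthonormal_basis (I : eqType) (e : I -> int * int -> quat R) : Prop :=
  [/\ forall a, l2 (e a),
      forall a b, inner (e a) (e b) = (a == b)%:R &
      forall f, l2 f -> forall eps : R, 0 < eps ->
        exists s, l2norm (fun k => f k - right_comb e s k) < eps].

Definition translation (N : nat) (n : int * int) f : int * int -> quat R :=
  fun k => f (k.1 - n.1 * N%:Z, k.2 - n.2 * N%:Z).

Definition modulation (M : nat) (m : 'I_M * 'I_M) f : int * int -> quat R :=
  fun k => qexp (qi R) (2 * pi * (m.1%:R / M%:R) * k.1%:~R) * f k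
         * qexp (qj R) (2 * pi * (m.2%:R / M%:R) * k.2%:~R).

Definition gabor (L M N : nat) (g : 'I_L -> int * int -> quat R)
    (a : 'I_L * ('I_M * 'I_M) * (int * int)) : int * int -> quat R :=
  let: (l, m, n) := a in modulation m (translation N n (g l)).

End QuaternionL2.

(* Main.v *)
(** Parseval's identity for a delta function at a point k gives
    sum_(l,m,n) |g_l (k - nN)|^2 = 1, since modulations preserve absolute
    values.  Summing over one k per residue class mod N collects every value
    |g_l k|^2 exactly M^2 times, so N^2 = M^2 sum_l |g_l|^2 = L M^2.

    Conversely N^2 = L M^2 forces N = r M and L = r^2.  Taking for the g_l the
    normalised indicators of the r^2 tiles of size M x M that form an N x N
    square, the translates by N Z^2 run through all M x M tiles of the plane,
    and on each tile the modulations form a basis by the orthogonality of the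
    M-th roots of unity in R[i] and R[j]. *)

Require Import Defs.
From mathcomp Require Import all_boot all_order all_algebra.
From mathcomp Require Import ring lra zify.
From mathcomp Require Import all_classical all_reals all_analysis.

Set Implicit Arguments.
Unset Strict Implicit.
Unset Printing Implicit Defensive.

Import Order.TTheory GRing.Theory Num.Theory.

Local Open Scope ring_scope.

(** * Absolutely summable families *)

(** Bounding finite subsums gives only one inequality. The other one is the same inequality for the
    factor [c^-1] and the family [c * f]. *)
Lemma esumZl (R : realType) (T : choiceType) (c : R) (f : T -> \bar R) :
  0 <= c -> (forall k, 0 <= f k)%E ->
  (\esum_(k in [set: T]) (c%:E * f k) = c%:E * \esum_(k in [set: T]) f k)%E.
Proof.
have le_esumZ (d : R) (g : T -> \bar R) : 0 <= d -> (forall k, 0 <= g k)%E ->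
    (\esum_(k in [set: T]) (d%:E * g k) <= d%:E * \esum_(k in [set: T]) g k)%E.
  move=> d0 g0; apply: ge_ereal_sup => _ [A [finA AT] <-].
  rewrite -ge0_mule_fsumr//; apply: lee_wpmul2l => //.
  by apply: ereal_sup_ubound; exists A.
rewrite le_eqVlt => /predU1P[<- _|c0 f0].
  by rewrite mul0e esum1// => k _; rewrite mul0e.
apply/le_anti/andP; split; first exact/le_esumZ/f0/ltW.
have -> : \esum_(k in [set: T]) f k =
    (\esum_(k in [set: T]) (c^-1%:E * (c%:E * f k)))%E.
  by apply: eq_esum => k _; rewrite muleA -EFinM mulVf ?gt_eqF// mul1e.
have := le_esumZ c^-1 (fun k => c%:E * f k)%E.
rewrite invr_ge0 ltW// => /(_ isT) H.
apply: le_trans (lee_wpmul2l _ (H _)) _.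
- by rewrite lee_fin ltW.
- by move=> k; rewrite mule_ge0// lee_fin ltW.
- by rewrite muleA -EFinM mulfV ?gt_eqF// mul1e.
Qed.

(** Under this condition both sums in [rsum] are finite, so that [fine] does not fall back on its
    default value 0. *)
Definition asum (R : realType) (u : int * int -> R) : Prop :=
  (\esum_(k in [set: int * int]) `|u k|%:E < +oo)%E.

Lemma asum_le (R : realType) (u v : int * int -> R) :
  (forall k, `|u k| <= v k) -> asum v -> asum u.
Proof.
move=> uv; apply: le_lt_trans; apply: le_esum => k _.
by rewrite lee_fin (le_trans (uv k))// ler_norm.
Qed.

Lemma asumD (R : realType) (u v : int * int -> R) :
  asum u -> asum v -> asum (fun k => u k + v k).
Proof.
move=> su sv; apply: le_lt_trans (lte_add_pinfty su sv).
rewrite -esumD; [|by move=> k _; rewrite lee_fin..].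
by apply: le_esum => k _; rewrite -EFinD lee_fin ler_normD.
Qed.

Lemma asumZ (R : realType) (c : R) (u : int * int -> R) :
  asum u -> asum (fun k => c * u k).
Proof.
move=> su; rewrite /asum.
under eq_esum do rewrite normrM EFinM.
rewrite esumZl// -ge0_fin_numE; last first.
  by rewrite mule_ge0// esum_ge0// => k _; rewrite lee_fin.
rewrite fin_numM// ge0_fin_numE//.
by rewrite esum_ge0// => k _; rewrite lee_fin.
Qed.

Lemma asumN (R : realType) (u : int * int -> R) :
  asum u -> asum (fun k => - u k).
Proof. by rewrite /asum; move=> su; under eq_esum do rewrite normrN. Qed.

Lemma esum_fin_num (R : realType) (u : int * int -> R) :
  asum u -> (forall k, 0 <= u k) ->
  (\esum_(k in [set: int * int]) (u k)%:E)%E \is a fin_num.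
Proof.
move=> su u0; rewrite ge0_fin_numE; last first.
  by apply: esum_ge0 => k _; rewrite lee_fin.
by move: su; rewrite /asum; under eq_esum do rewrite ger0_norm//.
Qed.

(** Any splitting into summable non-negative families computes [rsum], not only the canonical
    positive and negative parts. Linearity of [rsum] rests on this freedom: parts may be added and
    scaled separately. *)
Lemma rsum_ge0B (R : realType) (u v : int * int -> R) :
  asum u -> asum v -> (forall k, 0 <= u k) -> (forall k, 0 <= v k) ->
  rsum (fun k => u k - v k) =
    fine (\esum_(k in [set: int * int]) (u k)%:E)
    - fine (\esum_(k in [set: int * int]) (v k)%:E).
Proof.
move=> su sv u0 v0.
rewrite -fineB ?esum_fin_num//.
rewrite /rsum; congr fine.
rewrite -(@esumB _ _ setT (EFin \o u) (EFin \o v))//.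
- by move=> k _; rewrite lee_fin.
- by move=> k _; rewrite lee_fin.
Qed.

Lemma rsum_ge0E (R : realType) (u : int * int -> R) :
  (forall k, 0 <= u k) ->
  rsum u = fine (\esum_(k in [set: int * int]) (u k)%:E).
Proof.
move=> u0; rewrite /rsum; congr fine.
rewrite [X in (_ - X)%E]esum1 ?sube0.
  apply: eq_esum => k _; rewrite funeposE; apply/max_idPl.
  by rewrite lee_fin.
move=> k _; rewrite funenegE; apply/max_idPr.
by rewrite -EFinN lee_fin oppr_le0.
Qed.

Lemma asum_decomp (R : realType) (u : int * int -> R) : asum u ->
  exists p n, [/\ asum p, asum n, forall k, 0 <= p k, forall k, 0 <= n k
                & u = (fun k => p k - n k)].
Proof.
(* The positive and negative parts, in a form that linear arithmetic can handle. *)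
move=> su; exists (fun k => (`|u k| + u k) / 2), (fun k => (`|u k| - u k) / 2).
have abs_u : asum (fun k => `|u k|).
  by rewrite /asum; under eq_esum do rewrite normr_id.
have u1 k := ler_norm (u k); have u2 k := ler_norm (- u k).
split.
- apply: asum_le abs_u => k; move: (u1 k) (u2 k); rewrite normrN => ? ?.
  by rewrite ger0_norm; lra.
- apply: asum_le abs_u => k; move: (u1 k) (u2 k); rewrite normrN => ? ?.
  by rewrite ger0_norm; lra.
- by move=> k; move: (u1 k) (u2 k); rewrite normrN; lra.
- by move=> k; move: (u1 k) (u2 k); rewrite normrN; lra.
- by apply/funext => k; lra.
Qed.

Lemma rsumD (R : realType) (u v : int * int -> R) :
  asum u -> asum v -> rsum (fun k => u k + v k) = rsum u + rsum v.
Proof.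
move=> /asum_decomp[p [n [sp sn p0 n0 ->]]].
move=> /asum_decomp[q [m [sq sm q0 m0 ->]]].
have -> : (fun k => p k - n k + (q k - m k)) =
    (fun k => (p k + q k) - (n k + m k)) by apply/funext => k; lra.
rewrite !rsum_ge0B//; [|exact: asumD|exact: asumD
  |by move=> k; rewrite addr_ge0..].
under eq_esum do rewrite EFinD.
rewrite esumD; [|by move=> k _; rewrite lee_fin..].
under [X in _ - fine X]eq_esum do rewrite EFinD.
rewrite esumD; [|by move=> k _; rewrite lee_fin..].
by rewrite !fineD ?esum_fin_num//; lra.
Qed.

Lemma rsumN (R : realType) (u : int * int -> R) :
  asum u -> rsum (fun k => - u k) = - rsum u.
Proof.
move=> /asum_decomp[p [n [sp sn p0 n0 ->]]].
under [X in rsum X]eq_fun do rewrite opprB.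
by rewrite !rsum_ge0B// opprB.
Qed.

Lemma rsumZ (R : realType) (c : R) (u : int * int -> R) :
  asum u -> rsum (fun k => c * u k) = c * rsum u.
Proof.
have rsumZ_ge0 (d : R) (w : int * int -> R) : 0 <= d -> asum w ->
    rsum (fun k => d * w k) = d * rsum w.
  move=> d0 /asum_decomp[p [n [sp sn p0 n0 ->]]].
  under [X in rsum X]eq_fun do rewrite mulrBr.
  rewrite !rsum_ge0B//; [|exact: asumZ|exact: asumZ
    |by move=> k; rewrite mulr_ge0..].
  under eq_esum do rewrite EFinM.
  under [X in _ - fine X]eq_esum do rewrite EFinM.
  by rewrite !esumZl// !fineM ?esum_fin_num// mulrBr.
move=> su; have [c0|c0] := leP 0 c; first exact: rsumZ_ge0.
have -> : (fun k => c * u k) = (fun k => - (- c * u k)).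
  by apply/funext => k; rewrite mulNr opprK.
rewrite rsumN; last exact: asumZ.
by rewrite rsumZ_ge0// ?oppr_ge0 ?ltW// mulNr opprK.
Qed.

Lemma rsum0 (R : realType) : rsum (fun=> 0 : R) = 0.
Proof. by rewrite rsum_ge0E// esum1. Qed.

Lemma asum0 (R : realType) : asum (fun=> 0 : R).
Proof. by rewrite /asum esum1// => k _; rewrite normr0. Qed.

Lemma asum_delta (R : realType) (c : R) (k0 : int * int) :
  asum (fun k => if k == k0 then c else 0).
Proof.
rewrite /asum (_ : esum _ _ = `|c|%:E) ?ltry//.
rewrite -[RHS](@esum_set1 _ _ k0 (fun=> `|c|%:E))// [RHS]esum_mkcond.
apply: eq_esum => k _; have [->|kk0] := eqVneq k k0.
  by rewrite mem_set.
by rewrite memNset ?normr0//; exact/eqP.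
Qed.

Lemma rsum_delta (R : realType) (c : R) (k0 : int * int) :
  rsum (fun k => if k == k0 then c else 0) = c.
Proof.
have -> : (fun k => if k == k0 then c else 0) =
    (fun k => c * (if k == k0 then 1 else 0)).
  by apply/funext => k; case: ifP; rewrite ?mulr1 ?mulr0.
rewrite rsumZ; last exact: asum_delta.
rewrite rsum_ge0E; last by move=> k; case: ifP.
rewrite (_ : esum _ _ = 1%E) ?mulr1//.
rewrite -[RHS](@esum_set1 _ _ k0 (fun=> 1%E))// [RHS]esum_mkcond.
apply: eq_esum => k _; have [->|kk0] := eqVneq k k0.
  by rewrite mem_set.
by rewrite memNset//; exact/eqP.
Qed.

Lemma asum_sum (R : realType) (T : Type) (s : seq T) (u : T -> int * int -> R) :
  (forall t, asum (u t)) -> asum (fun k => \sum_(t <- s) u t k).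
Proof.
move=> su; elim: s => [|t s IH].
  by under [X in asum X]eq_fun do rewrite big_nil; exact: asum0.
by under [X in asum X]eq_fun do rewrite big_cons; exact: asumD.
Qed.

Lemma rsum_sum (R : realType) (T : Type) (s : seq T) (u : T -> int * int -> R) :
  (forall t, asum (u t)) ->
  rsum (fun k => \sum_(t <- s) u t k) = \sum_(t <- s) rsum (u t).
Proof.
move=> su; elim: s => [|t s IH].
  by under [X in rsum X]eq_fun do rewrite big_nil; rewrite big_nil rsum0.
under [X in rsum X]eq_fun do rewrite big_cons.
by rewrite rsumD ?IH ?big_cons//; exact: asum_sum.
Qed.

(** A finitely supported family becomes a finite sum of one-point families, for which summability
    and the sum are known. *)
Lemma finite_support_sum (V : zmodType) (s : seq (int * int))
    (u : int * int -> V) :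
  uniq s -> (forall k, k \notin s -> u k = 0) ->
  u = (fun k => \sum_(t <- s) if k == t then u t else 0).
Proof.
move=> us u0; apply/funext => k.
have [ks|ks] := boolP (k \in s).
  rewrite (bigD1_seq k)//= eqxx big1 ?addr0// => t.
  by rewrite eq_sym => /negPf ->.
rewrite u0// big_seq big1// => t ts; case: eqP => // kt.
by rewrite kt ts in ks.
Qed.

Lemma asum_finite_support (R : realType) (s : seq (int * int))
    (u : int * int -> R) :
  uniq s -> (forall k, k \notin s -> u k = 0) -> asum u.
Proof.
move=> us u0; rewrite (finite_support_sum us u0).
by apply: asum_sum => t; exact: asum_delta.
Qed.

Lemma rsum_finite_support (R : realType) (s : seq (int * int))
    (u : int * int -> R) :
  uniq s -> (forall k, k \notin s -> u k = 0) -> rsum u = \sum_(k <- s) u k.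
Proof.
move=> us u0; rewrite {1}(finite_support_sum us u0) rsum_sum.
  by apply: eq_bigr => k _; exact: rsum_delta.
by move=> t; exact: asum_delta.
Qed.

(** * Quaternions *)

Lemma quatP (R : realType) (x y : quat R) :
  qre x = qre y -> qimi x = qimi y -> qimj x = qimj y -> qimk x = qimk y ->
  x = y.
Proof. by case: x y => [a b c d] [a' b' c' d'] /= -> -> -> ->. Qed.

Lemma qabs_sqr (R : realType) (x : quat R) :
  qabs x ^+ 2 = qre x ^+ 2 + qimi x ^+ 2 + qimj x ^+ 2 + qimk x ^+ 2.
Proof. by rewrite sqr_sqrtr// !addr_ge0// sqr_ge0. Qed.

Lemma qabs_ge0 (R : realType) (x : quat R) : 0 <= qabs x.
Proof. exact: sqrtr_ge0. Qed.

(** Euler's four-square identity under the square root. *)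
Lemma qabsM (R : realType) (x y : quat R) : qabs (x * y) = qabs x * qabs y.
Proof.
rewrite -sqrtrM; last by rewrite !addr_ge0// sqr_ge0.
by congr Num.sqrt => /=; ring.
Qed.

Lemma qabs_conj (R : realType) (x : quat R) : qabs (qconj x) = qabs x.
Proof. by congr Num.sqrt; rewrite /= !sqrrN. Qed.

Lemma qabs0 (R : realType) : qabs (0 : quat R) = 0.
Proof. by rewrite /qabs /= !expr0n /= !addr0 sqrtr0. Qed.

Lemma qabs_eq0 (R : realType) (x : quat R) : (qabs x == 0) = (x == 0).
Proof.
apply/eqP/eqP => [x0|->]; last exact: qabs0.
have := qabs_sqr x; rewrite x0 expr0n/= => /esym/eqP.
rewrite !paddr_eq0 ?addr_ge0 ?sqr_ge0// !sqrf_eq0.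
by move=> /andP[/andP[/andP[/eqP a /eqP b] /eqP c] /eqP d]; exact: quatP.
Qed.

Lemma quat_mulf_eq0 (R : realType) (x y : quat R) :
  x * y = 0 -> x = 0 \/ y = 0.
Proof.
move=> /(congr1 (@qabs R))/eqP; rewrite qabsM qabs0 mulf_eq0 !qabs_eq0.
by move=> /orP[/eqP|/eqP]; [left|right].
Qed.

Lemma qconjK (R : realType) : involutive (@qconj R).
Proof. by move=> x; apply: quatP; rewrite /= ?opprK. Qed.

Lemma qconjM (R : realType) (x y : quat R) : qconj (x * y) = qconj y * qconj x.
Proof. by apply: quatP => /=; ring. Qed.

Lemma qconj0 (R : realType) : qconj 0 = 0 :> quat R.
Proof. by apply: quatP => //=; rewrite oppr0. Qed.

Lemma qconj1 (R : realType) : qconj 1 = 1 :> quat R.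
Proof. by apply: quatP => //=; rewrite oppr0. Qed.

Lemma mul_qconj (R : realType) (x : quat R) : qconj x * x = qreal (qabs x ^+ 2).
Proof. by rewrite qabs_sqr; apply: quatP => /=; ring. Qed.

Lemma qreD (R : realType) (x y : quat R) : qre (x + y) = qre x + qre y.
Proof. by []. Qed.

Lemma qre_sum (R : realType) (T : Type) (s : seq T) (F : T -> quat R) :
  qre (\sum_(t <- s) F t) = \sum_(t <- s) qre (F t).
Proof. exact: (big_morph (@qre R) (@qreD R) erefl). Qed.

(** These are exactly the square roots of -1, so [qi] and [qj] can share one theory of [qexp]. *)
Definition imag_unit (R : realType) (u : quat R) : Prop :=
  qre u = 0 /\ qabs u = 1.

Lemma imag_unit_qi (R : realType) : imag_unit (qi R).
Proof. by split; rewrite // /qabs /= !expr0n expr1n /= !addr0 add0r sqrtr1. Qed.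

Lemma imag_unit_qj (R : realType) : imag_unit (qj R).
Proof. by split; rewrite // /qabs /= !expr0n expr1n /= !addr0 add0r sqrtr1. Qed.

Lemma qrealC (R : realType) (a : R) (x : quat R) : qreal a * x = x * qreal a.
Proof. by apply: quatP => /=; ring. Qed.

Lemma qrealM (R : realType) (a b : R) : qreal (a * b) = qreal a * qreal b.
Proof. by apply: quatP => /=; ring. Qed.

Lemma qreal_conj (R : realType) (a : R) : qconj (qreal a) = qreal a.
Proof. by apply: quatP => /=; rewrite ?oppr0. Qed.

Lemma qexpD (R : realType) (u : quat R) (s t : R) : imag_unit u ->
  qexp u (s + t) = qexp u s * qexp u t.
Proof.
move=> [u0 u1]; have := qabs_sqr u; rewrite u1 u0 expr1n expr0n/= add0r => E.
apply: quatP => /=; rewrite ?cosD ?sinD u0.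
(* The factor 1 is written out so that [E] can turn it into the sum of the squared imaginary
   coordinates of [u]. *)
- transitivity (cos s * cos t - sin s * sin t * 1); first by ring.
  by rewrite E; ring.
- by ring.
- by ring.
- by ring.
Qed.

Lemma qexp0 (R : realType) (u : quat R) : qexp u 0 = 1.
Proof. by rewrite /qexp cos0 sin0; apply: quatP => /=; ring. Qed.

Lemma qexp_conj (R : realType) (u : quat R) (t : R) : imag_unit u ->
  qconj (qexp u t) = qexp u (- t).
Proof.
by move=> [u0 _]; apply: quatP => /=; rewrite ?cosN ?sinN u0; ring.
Qed.

Lemma qexpMn (R : realType) (u : quat R) (t : R) (n : nat) : imag_unit u ->
  qexp u (t *+ n) = qexp u t ^+ n.
Proof.
move=> hu; elim: n => [|n IH]; first by rewrite mulr0n qexp0 expr0.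
by rewrite mulrS qexpD// IH exprS.
Qed.

Lemma qexp_2pi (R : realType) (u : quat R) (z : int) : imag_unit u ->
  qexp u (2 * pi * z%:~R) = 1.
Proof.
move=> hu; have nat1 (n : nat) : qexp u (2 * pi * n%:R) = 1.
  rewrite mulr_natr qexpMn// (_ : qexp u _ = 1) ?expr1n//.
  rewrite mulrC mulr_natr /qexp cos2pi sin2pi.
  by apply: quatP => /=; ring.
case: z => n; first exact: nat1.
by rewrite NegzE intrN mulrN -qexp_conj// nat1 qconj1.
Qed.

Lemma qabs_qexp (R : realType) (u : quat R) (t : R) :
  imag_unit u -> qabs (qexp u t) = 1.
Proof.
move=> [u0 u1]; rewrite /qabs -[RHS]sqrtr1; congr Num.sqrt => /=.
have := qabs_sqr u; rewrite u1 u0 expr1n => E.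
rewrite -(cos2Dsin2 t) -[sin t ^+ 2]mul1r E; ring.
Qed.

(** * The inner product of l2 *)

Definition qasum (R : realType) (u : int * int -> quat R) : Prop :=
  [/\ asum (fun k => qre (u k)), asum (fun k => qimi (u k)),
      asum (fun k => qimj (u k)) & asum (fun k => qimk (u k))].

Lemma qsumD (R : realType) (u v : int * int -> quat R) :
  qasum u -> qasum v -> qsum (fun k => u k + v k) = qsum u + qsum v.
Proof. by move=> [? ? ? ?] [? ? ? ?]; apply: quatP; rewrite /= rsumD. Qed.

(** Each coordinate of [u k * q] is a real combination of the four coordinates of [u k], so real
    linearity of [rsum] suffices. *)
Lemma qsumMr (R : realType) (u : int * int -> quat R) (q : quat R) :
  qasum u -> qsum (fun k => u k * q) = qsum u * q.
Proof.
have rsum4 (a b c d : R) (w x y z : int * int -> R) :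
    asum w -> asum x -> asum y -> asum z ->
    rsum (fun k => a * w k + b * x k + c * y k + d * z k) =
    a * rsum w + b * rsum x + c * rsum y + d * rsum z.
  move=> sw sx sy sz; have za := asumZ a sw; have zb := asumZ b sx.
  have zc := asumZ c sy; have zd := asumZ d sz.
  rewrite (rsumD (asumD (asumD za zb) zc) zd) (rsumD (asumD za zb) zc).
  by rewrite (rsumD za zb) !rsumZ.
move=> [s0 s1 s2 s3]; apply: quatP.
- transitivity (qre q * rsum (fun k => qre (u k))
    + - qimi q * rsum (fun k => qimi (u k))
    + - qimj q * rsum (fun k => qimj (u k))
    + - qimk q * rsum (fun k => qimk (u k))); last by rewrite /=; ring.
  by rewrite -rsum4//; congr rsum; apply/funext => k /=; ring.
- transitivity (qimi q * rsum (fun k => qre (u k))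
    + qre q * rsum (fun k => qimi (u k))
    + qimk q * rsum (fun k => qimj (u k))
    + - qimj q * rsum (fun k => qimk (u k))); last by rewrite /=; ring.
  by rewrite -rsum4//; congr rsum; apply/funext => k /=; ring.
- transitivity (qimj q * rsum (fun k => qre (u k))
    + - qimk q * rsum (fun k => qimi (u k))
    + qre q * rsum (fun k => qimj (u k))
    + qimi q * rsum (fun k => qimk (u k))); last by rewrite /=; ring.
  by rewrite -rsum4//; congr rsum; apply/funext => k /=; ring.
- transitivity (qimk q * rsum (fun k => qre (u k))
    + qimj q * rsum (fun k => qimi (u k))
    + - qimi q * rsum (fun k => qimj (u k))
    + qre q * rsum (fun k => qimk (u k))); last by rewrite /=; ring.
  by rewrite -rsum4//; congr rsum; apply/funext => k /=; ring.
Qed.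

Lemma qsum_conj (R : realType) (u : int * int -> quat R) :
  qasum u -> qsum (fun k => qconj (u k)) = qconj (qsum u).
Proof. by move=> [? ? ? ?]; apply: quatP; rewrite //= rsumN. Qed.

Lemma qsum_finite_support (R : realType) (s : seq (int * int))
    (u : int * int -> quat R) :
  uniq s -> (forall k, k \notin s -> u k = 0) -> qsum u = \sum_(k <- s) u k.
Proof.
have D p (pD : {morph p : x y / x + y :> quat R >-> (x + y : R)})
    (p0 : p 0 = 0) :
    uniq s -> (forall k, k \notin s -> u k = 0) ->
    rsum (fun k => p (u k)) = p (\sum_(k <- s) u k).
  move=> us u0; rewrite (big_morph p pD p0) (rsum_finite_support us)// => k ks.
  by rewrite u0.
by move=> us u0; apply: quatP; rewrite /= D.
Qed.

Lemma l2E (R : realType) (f : int * int -> quat R) :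
  l2 f = asum (fun k => qabs (f k) ^+ 2).
Proof. by rewrite /asum; under eq_esum do rewrite ger0_norm ?sqr_ge0//. Qed.

Lemma l2_finite_support (R : realType) (s : seq (int * int))
    (f : int * int -> quat R) :
  uniq s -> (forall k, k \notin s -> f k = 0) -> l2 f.
Proof.
move=> us f0; rewrite l2E; apply: (asum_finite_support us) => k ks.
by rewrite f0// qabs0 expr0n.
Qed.

Lemma l2D (R : realType) (f g : int * int -> quat R) :
  l2 f -> l2 g -> l2 (fun k => f k + g k).
Proof.
rewrite !l2E => sf sg.
apply: asum_le (asumD (asumZ 2 sf) (asumZ 2 sg)) => k.
rewrite ger0_norm ?sqr_ge0// !qabs_sqr/=.
have sqD (a b : R) : (a + b) ^+ 2 <= 2 * a ^+ 2 + 2 * b ^+ 2.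
  by have := sqr_ge0 (a - b); rewrite !expr2; lra.
have := sqD (qre (f k)) (qre (g k)); have := sqD (qimi (f k)) (qimi (g k)).
have := sqD (qimj (f k)) (qimj (g k)); have := sqD (qimk (f k)) (qimk (g k)).
lra.
Qed.

Lemma l2Mr (R : realType) (f : int * int -> quat R) (q : quat R) :
  l2 f -> l2 (fun k => f k * q).
Proof.
rewrite !l2E => /(asumZ (qabs q ^+ 2)); congr asum.
by apply/funext => k; rewrite qabsM exprMn mulrC.
Qed.

Lemma l2_right_comb (R : realType) (I : Type) (e : I -> int * int -> quat R)
    (s : seq (I * quat R)) : (forall a, l2 (e a)) -> l2 (right_comb e s).
Proof.
move=> le; elim: s => [|[a q] s IH].
  apply: (@l2_finite_support _ [::]) => // k _.
  by rewrite /right_comb big_nil.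
have -> : right_comb e ((a, q) :: s) = (fun k => e a k * q + right_comb e s k).
  by apply/funext => k; rewrite /right_comb big_cons.
by apply: l2D => //; exact: l2Mr.
Qed.

(** Each coordinate of the product is at most |f k| |g k| in absolute value, hence at most |f k|^2 +
    |g k|^2. *)
Lemma qasum_inner (R : realType) (f g : int * int -> quat R) :
  l2 f -> l2 g -> qasum (fun k => qconj (f k) * g k).
Proof.
rewrite !l2E => sf sg; have sfg := asumD sf sg.
have bound (a : R) k : a ^+ 2 <= qabs (qconj (f k) * g k) ^+ 2 ->
    `|a| <= qabs (f k) ^+ 2 + qabs (g k) ^+ 2.
  rewrite -(real_normK (num_real a)) ler_sqr ?nnegrE ?qabs_ge0//.
  rewrite qabsM qabs_conj => /le_trans; apply.
  have := sqr_ge0 (qabs (f k) - qabs (g k)).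
  by have := mulr_ge0 (qabs_ge0 (f k)) (qabs_ge0 (g k)); rewrite !expr2; lra.
have sq4 (x : quat R) : [/\ 0 <= qre x ^+ 2, 0 <= qimi x ^+ 2,
    0 <= qimj x ^+ 2 & 0 <= qimk x ^+ 2] by split; exact: sqr_ge0.
by split; apply: asum_le sfg => k; apply: bound; rewrite (qabs_sqr (_ * _));
  have [? ? ? ?] := sq4 (qconj (f k) * g k); lra.
Qed.

Lemma innerDr (R : realType) (f g h : int * int -> quat R) :
  l2 f -> l2 g -> l2 h ->
  inner f (fun k => g k + h k) = inner f g + inner f h.
Proof.
move=> lf lg lh; rewrite /inner -qsumD; [|exact: qasum_inner..].
by congr qsum; apply/funext => k; rewrite mulrDr.
Qed.

Lemma innerMr (R : realType) (f g : int * int -> quat R) (q : quat R) :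
  l2 f -> l2 g -> inner f (fun k => g k * q) = inner f g * q.
Proof.
move=> lf lg; rewrite /inner -qsumMr; last exact: qasum_inner.
by congr qsum; apply/funext => k; rewrite mulrA.
Qed.

Lemma inner_conj (R : realType) (f g : int * int -> quat R) :
  l2 f -> l2 g -> qconj (inner f g) = inner g f.
Proof.
move=> lf lg; rewrite /inner -qsum_conj; last exact: qasum_inner.
by congr qsum; apply/funext => k; rewrite qconjM qconjK.
Qed.

Lemma inner_self (R : realType) (f : int * int -> quat R) :
  inner f f = qreal (rsum (fun k => qabs (f k) ^+ 2)).
Proof.
rewrite /inner; have -> : (fun k => qconj (f k) * f k) =
    (fun k => qreal (qabs (f k) ^+ 2)).
  by apply/funext => k; exact: mul_qconj.
by apply: quatP; rewrite //= rsum0.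
Qed.

Lemma inner_self_ge0 (R : realType) (f : int * int -> quat R) :
  0 <= qre (inner f f).
Proof.
rewrite inner_self rsum_ge0E /=; last by move=> k; exact: sqr_ge0.
by rewrite fine_ge0// esum_ge0// => k _; rewrite lee_fin sqr_ge0.
Qed.

Lemma inner0r (R : realType) (f : int * int -> quat R) :
  inner f (fun=> 0) = 0.
Proof.
rewrite /inner; under [X in qsum X]eq_fun do rewrite mulr0.
by apply: quatP; rewrite /= rsum0.
Qed.

Lemma inner_right_comb (R : realType) (I : Type) (e : I -> int * int -> quat R)
    (f : int * int -> quat R) (s : seq (I * quat R)) :
  l2 f -> (forall a, l2 (e a)) ->
  inner f (right_comb e s) = \sum_(p <- s) inner f (e p.1) * p.2.
Proof.
move=> lf le; elim: s => [|[a q] s IH].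
  rewrite big_nil -[RHS](inner0r f); congr inner.
  by apply/funext => k; rewrite /right_comb big_nil.
have -> : right_comb e ((a, q) :: s) = (fun k => e a k * q + right_comb e s k).
  by apply/funext => k; rewrite /right_comb big_cons.
rewrite innerDr//; [|exact: l2Mr|exact: l2_right_comb].
by rewrite innerMr// IH big_cons.
Qed.

(** * Parseval's identity *)

Lemma innerNr (R : realType) (f g : int * int -> quat R) :
  l2 f -> l2 g -> inner f (fun k => - g k) = - inner f g.
Proof.
move=> lf lg; rewrite -[RHS]mulrN1 -innerMr//; congr inner.
by apply/funext => k; rewrite mulrN1.
Qed.

Lemma l2N (R : realType) (f : int * int -> quat R) :
  l2 f -> l2 (fun k => - f k).
Proof.
move=> /(l2Mr (-1)); congr l2.
by apply/funext => k; rewrite mulrN1.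
Qed.

(** For orthonormal [e] and duplicate-free [F] this is the orthogonal projection of [f] onto the
    right span of the vectors indexed by [F]. A repeated index would count twice, hence the [uniq]
    hypotheses below. *)
Definition fourier_comb (R : realType) (I : eqType)
    (e : I -> int * int -> quat R) (f : int * int -> quat R) (F : seq I) :=
  right_comb e [seq (a, inner (e a) f) | a <- F].

Lemma inner_fourier_comb (R : realType) (I : eqType)
    (e : I -> int * int -> quat R) (f : int * int -> quat R) (F : seq I)
    (b : I) :
  (forall a, l2 (e a)) -> (forall a c, inner (e a) (e c) = (a == c)%:R) ->
  uniq F -> b \in F -> inner (e b) (fourier_comb e f F) = inner (e b) f.
Proof.
move=> le oe uF bF; rewrite inner_right_comb// big_map.
rewrite (bigD1_seq b)//= oe eqxx mul1r big1 ?addr0// => a ab.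
by rewrite oe eq_sym (negPf ab) mul0r.
Qed.

Lemma l2_fourier_residual (R : realType) (I : eqType)
    (e : I -> int * int -> quat R) (f : int * int -> quat R) (F : seq I) :
  (forall a, l2 (e a)) -> l2 f -> l2 (fun k => f k - fourier_comb e f F k).
Proof. by move=> le lf; apply: l2D => //; apply: l2N; exact: l2_right_comb. Qed.

Lemma fourier_residual_orthogonal (R : realType) (I : eqType)
    (e : I -> int * int -> quat R) (f : int * int -> quat R) (F : seq I)
    (t : seq (I * quat R)) :
  (forall a, l2 (e a)) -> (forall a c, inner (e a) (e c) = (a == c)%:R) ->
  l2 f -> uniq F -> {subset [seq p.1 | p <- t] <= F} ->
  inner (fun k => f k - fourier_comb e f F k) (right_comb e t) = 0.
Proof.
move=> le oe lf uF tF; have lP := l2_fourier_residual F le lf.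
have lQ : l2 (fourier_comb e f F) by exact: l2_right_comb.
rewrite inner_right_comb// big_seq big1// => p pt.
rewrite -inner_conj// innerDr//; last exact: l2N.
rewrite innerNr// inner_fourier_comb// ?subrr ?qconj0 ?mul0r//.
by rewrite tF// map_f.
Qed.

(** Pythagoras: the residual is orthogonal to the projection, so only its product with [f] survives.
    Since the left side is non-negative, Bessel's inequality follows. *)
Lemma fourier_residual_norm (R : realType) (I : eqType)
    (e : I -> int * int -> quat R) (f : int * int -> quat R) (F : seq I) :
  (forall a, l2 (e a)) -> (forall a c, inner (e a) (e c) = (a == c)%:R) ->
  l2 f -> uniq F ->
  qre (inner (fun k => f k - fourier_comb e f F k)
             (fun k => f k - fourier_comb e f F k)) =
  qre (inner f f) - \sum_(a <- F) qabs (inner (e a) f) ^+ 2.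
Proof.
move=> le oe lf uF; have lP := l2_fourier_residual F le lf.
have lQ : l2 (fourier_comb e f F) by exact: l2_right_comb.
rewrite innerDr//; last exact: l2N.
rewrite innerNr// fourier_residual_orthogonal//; last first.
  by move=> b; rewrite -map_comp map_id.
rewrite subr0 -inner_conj// innerDr//; last exact: l2N.
rewrite innerNr// inner_right_comb// big_map /=; congr (_ - _).
rewrite qre_sum; apply: eq_bigr => a _.
by rewrite -(inner_conj (le a) lf) mul_qconj.
Qed.

Lemma best_approximation (R : realType) (I : eqType)
    (e : I -> int * int -> quat R) (f : int * int -> quat R) (F : seq I)
    (s : seq (I * quat R)) :
  (forall a, l2 (e a)) -> (forall a c, inner (e a) (e c) = (a == c)%:R) ->
  l2 f -> uniq F -> {subset [seq p.1 | p <- s] <= F} ->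
  qre (inner f f) - \sum_(a <- F) qabs (inner (e a) f) ^+ 2 <=
  qre (inner (fun k => f k - right_comb e s k)
             (fun k => f k - right_comb e s k)).
Proof.
move=> le oe lf uF sF; rewrite -fourier_residual_norm//.
set P := fun k => f k - fourier_comb e f F k.
(* The error of the competitor [s] is [P + W] with [W] in the span of [F], hence orthogonal to [P].
   So [W] can only add to the squared norm. *)
pose W k := fourier_comb e f F k - right_comb e s k.
have lP : l2 P by exact: l2_fourier_residual.
have lQ : l2 (fourier_comb e f F) by exact: l2_right_comb.
have lC : l2 (right_comb e s) by exact: l2_right_comb.
have lW : l2 W by apply: l2D => //; exact: l2N.
have PW : inner P W = 0.
  rewrite innerDr//; last exact: l2N.
  rewrite innerNr// !fourier_residual_orthogonal ?subr0//.
  by move=> b; rewrite -map_comp map_id.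
have -> : (fun k => f k - right_comb e s k) = (fun k => P k + W k).
  by apply/funext => k; rewrite /P /W addrA subrK.
have lPW : l2 (fun k => P k + W k) by exact: l2D.
rewrite (innerDr lPW lP lW) -(inner_conj lP lPW) -(inner_conj lW lPW).
rewrite (innerDr lP lP lW) (innerDr lW lP lW).
rewrite PW -(inner_conj lP lW) PW qconj0 addr0 add0r.
have qre_conj (x : quat R) : qre (qconj x) = qre x by [].
by rewrite qreD !qre_conj lerDl inner_self_ge0.
Qed.

Lemma parseval (R : realType) (I : choiceType)
    (e : I -> int * int -> quat R) (f : int * int -> quat R) :
  orthonormal_basis e -> l2 f ->
  (\esum_(a in [set: I]) (qabs (inner (e a) f) ^+ 2)%:E =
   (qre (inner f f))%:E)%E.
Proof.
move=> [le oe de] lf.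
apply/le_anti/andP; split.
  (* Bessel's inequality bounds every finite subsum. *)
  apply: ge_ereal_sup => _ [A [/finite_seqP[s ->] _] <-].
  have -> : [set` s]%classic = [set` undup s]%classic.
    by apply/seteqP; split=> x /=; rewrite mem_undup.
  rewrite -fsbig_seq ?undup_uniq// sumEFin lee_fin -subr_ge0.
  rewrite -fourier_residual_norm ?undup_uniq//.
  exact: inner_self_ge0.
apply/lee_addgt0Pr => eps eps0.
(* Density is used at distance [Num.sqrt eps], so that the squared error is below [eps]. By best
   approximation the Fourier residual over the indices used is no larger. *)
have sqrt_eps0 : 0 < Num.sqrt eps by rewrite sqrtr_gt0.
have [s] := de _ lf _ sqrt_eps0; rewrite /l2norm ltr_sqrt// => seps.
pose F := undup [seq p.1 | p <- s].
have uF : uniq F by exact: undup_uniq.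
have sF : {subset [seq p.1 | p <- s] <= F} by move=> a; rewrite mem_undup.
have := le_lt_trans (best_approximation le oe lf uF sF) seps.
rewrite ltrBlDr => /ltW H.
apply: (@le_trans _ _ ((eps + \sum_(a <- F) qabs (inner (e a) f) ^+ 2)%:E)).
  by rewrite lee_fin.
rewrite EFinD addeC leeD2r// -sumEFin fsbig_seq//.
by apply: esum_ge; exists [set` F]%classic.
Qed.

Lemma l2_delta (R : realType) (k0 : int * int) :
  l2 (fun k => (k == k0)%:R : quat R).
Proof.
apply: (@l2_finite_support _ [:: k0]) => // k.
by rewrite inE => /negPf ->.
Qed.

Lemma inner_delta (R : realType) (f : int * int -> quat R) (k0 : int * int) :
  inner f (fun k => (k == k0)%:R) = qconj (f k0).
Proof.
rewrite /inner (@qsum_finite_support _ [:: k0])//.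
  by rewrite big_seq1 eqxx mulr1.
by move=> k; rewrite inE => /negPf ->; rewrite mulr0.
Qed.

(** The coefficient of a delta function at [k] along [e a] is the conjugate of [e a k]. *)
Lemma parseval_delta (R : realType) (I : choiceType)
    (e : I -> int * int -> quat R) (k : int * int) :
  orthonormal_basis e ->
  (\esum_(a in [set: I]) (qabs (e a k) ^+ 2)%:E = 1)%E.
Proof.
move=> be; have := parseval be (l2_delta R k).
rewrite inner_delta eqxx qconj1 => <-.
by apply: eq_esum => a _; rewrite inner_delta qabs_conj.
Qed.

(** Finitely supported functions are dense in l2, and they are right combinations of delta
    functions. *)
Lemma dense_of_delta (R : realType) (I : eqType)
    (e : I -> int * int -> quat R) :
  (forall k0, exists s, forall k, right_comb e s k = (k == k0)%:R) ->
  forall f, l2 f -> forall eps : R, 0 < eps ->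
    exists s, l2norm (fun k => f k - right_comb e s k) < eps.
Proof.
move=> /choice[c cE] f lf eps eps0.
have f0 k : 0 <= qabs (f k) ^+ 2 by exact: sqr_ge0.
have lf' := lf; rewrite l2E in lf'.
have fin := esum_fin_num lf' f0.
have : (\esum_(k in [set: int * int]) (qabs (f k) ^+ 2)%:E - (eps ^+ 2)%:E <
    \esum_(k in [set: int * int]) (qabs (f k) ^+ 2)%:E)%E.
  by rewrite lteBlDr// lteDl// lte_fin exprn_gt0.
move=> /ereal_sup_gt[_ [A [/finite_seqP[s0 ->] _] <-]].
pose s := undup s0.
have us : uniq s by exact: undup_uniq.
have -> : [set` s0]%classic = [set` s]%classic.
  by apply/seteqP; split=> x /=; rewrite mem_undup.
rewrite -fsbig_seq// sumEFin -(fineK fin) -EFinB lte_fin -rsum_ge0E// => near_f.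
(* The expansion of each delta at [k0] in [s], scaled on the right by [f k0]. Together they
   reproduce [f] on [s] and vanish elsewhere, so the error is the tail of [f]. *)
exists (flatten [seq [seq (p.1, p.2 * f k0) | p <- c k0] | k0 <- s]).
rewrite (_ : (fun k => _) = (fun k => if k \in s then 0 else f k)); last first.
  apply/funext => k; rewrite /right_comb big_flatten big_map.
  rewrite (eq_bigr (fun k0 => (k == k0)%:R * f k0)); last first.
    move=> k0 _; rewrite big_map -cE /right_comb mulr_suml.
    by apply: eq_bigr => p _; rewrite mulrA.
  case: ifPn => ks.
    rewrite (bigD1_seq k)//= eqxx mul1r big1 ?addr0 ?subrr// => k0.
    by rewrite eq_sym => /negPf ->; rewrite mul0r.
  rewrite big_seq big1 ?subr0// => k0 k0s; case: eqP => [kk0|_].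
    by rewrite kk0 k0s in ks.
  by rewrite mul0r.
rewrite -(ger0_norm (ltW eps0)) -sqrtr_sqr /l2norm ltr_sqrt ?exprn_gt0//.
rewrite inner_self /=.
have tail k : qabs (if k \in s then 0 else f k) ^+ 2 =
    qabs (f k) ^+ 2 - (if k \in s then qabs (f k) ^+ 2 else 0).
  by case: ifP; rewrite ?qabs0 ?expr0n/= ?subrr ?subr0.
under [X in rsum X]eq_fun do rewrite tail.
have u0 k : k \notin s -> (if k \in s then qabs (f k) ^+ 2 else 0) = 0.
  by move=> /negPf ->.
rewrite rsumD ?rsumN//; [|exact: asum_finite_support us u0
  |by apply: asumN; exact: asum_finite_support us u0].
rewrite (rsum_finite_support us u0) big_seq.
rewrite (eq_bigr (fun k => qabs (f k) ^+ 2)); last by move=> k ->.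
by rewrite -big_seq; move: near_f; lra.
Qed.

(** * Necessity of the density condition *)

(** Euclidean division in each coordinate. The quotient enters with a minus sign to match the
    argument [k - n N] of a translate. *)
Lemma divz_mod_bij (N : nat) : (0 < N)%N ->
  set_bij setT setT (fun p : ('I_N * 'I_N) * (int * int) =>
    ((p.1.1%:Z - p.2.1 * N%:Z)%R, (p.1.2%:Z - p.2.2 * N%:Z)%R)).
Proof.
move=> N0.
have uniq_div (r r' : 'I_N) (n n' : int) :
    r%:Z - n * N%:Z = r'%:Z - n' * N%:Z -> r = r' /\ n = n'.
  move=> H; have lr := ltn_ord r; have lr' := ltn_ord r'.
  have nn : n = n' by nia.
  by subst n'; split=> //; apply: ord_inj; lia.
have ex_div (k : int) : exists r : 'I_N, exists n, k = r%:Z - n * N%:Z.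
  have lk : (`|(k %% N)%Z|%N < N)%N.
    have := ltz_pmod k (_ : 0 < N%:Z).
    by have := modz_ge0 k (_ : N%:Z != 0); lia.
  exists (Ordinal lk), (- (k %/ N)%Z) => /=.
  have := divz_eq k N%:Z; have := modz_ge0 k (_ : N%:Z != 0); lia.
split=> //.
- move=> [[r1 r2] [n1 n2]] [[s1 s2] [m1 m2]] _ _ /= [/uniq_div[-> ->]].
  by move=> /uniq_div[-> ->].
- move=> [k1 k2] _; have [r1 [n1 ->]] := ex_div k1.
  by have [r2 [n2 ->]] := ex_div k2; exists ((r1, r2), (n1, n2)).
Qed.

Lemma qabs_modulation (R : realType) (M : nat) (m : 'I_M * 'I_M)
    (f : int * int -> quat R) (k : int * int) :
  qabs (modulation m f k) = qabs (f k).
Proof.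
rewrite /modulation !qabsM (qabs_qexp _ (imag_unit_qi R)).
by rewrite (qabs_qexp _ (imag_unit_qj R)) mul1r mulr1.
Qed.

Lemma esum_finType_prod (R : realType) (X : finType) (T : choiceType)
    (v : X * T -> \bar R) : (forall a, 0 <= v a)%E ->
  (\esum_(a in [set: X * T]) v a
   = \sum_(x : X) \esum_(t in [set: T]) v (x, t))%E.
Proof.
move=> v0; transitivity
    (\esum_(x in [set: X]) \esum_(t in [set: T]) v (x, t))%E.
  rewrite esum_esum//; congr esum; last by apply/funext => -[].
  by apply/seteqP; split.
have -> : [set: X]%classic = [set` enum X]%classic.
  by apply/seteqP; split=> x //= _; rewrite mem_enum.
rewrite esum_fset//.
  by rewrite -fsbig_seq ?enum_uniq// big_enum.
by move=> x _; exact: esum_ge0.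
Qed.

Lemma gabor_card (R : realType) (L M N : nat)
    (g : 'I_L -> int * int -> quat R) :
  (0 < M)%N -> (0 < N)%N -> (forall l, l2 (g l)) ->
  orthonormal_basis (gabor (M := M) N g) -> (N ^ 2 = L * M ^ 2)%N.
Proof.
move=> M0 N0 lg bg.
have qabs_gabor l m n k : qabs (gabor N g (l, m, n) k) =
    qabs (g l (k.1 - n.1 * N%:Z, k.2 - n.2 * N%:Z)).
  by rewrite /gabor qabs_modulation.
(* The member with m = 0 and n = 0 has norm 1, and modulation preserves absolute values, so each
   window has norm 1 as well. *)
have g1 l : (\esum_(k in [set: int * int]) (qabs (g l k) ^+ 2)%:E = 1)%E.
  have [_ + _] := bg; pose m0 : 'I_M := Ordinal M0.
  move=> /(_ (l, (m0, m0), (0, 0)) (l, (m0, m0), (0, 0))).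
  rewrite eqxx inner_self => /(congr1 (@qre R)) /=.
  rewrite rsum_ge0E; last by move=> k; exact: sqr_ge0.
  under eq_esum => k _ do
    rewrite qabs_gabor /= !mul0r !subr0 -surjective_pairing.
  move=> <-; rewrite fineK// ge0_fin_numE; first exact: lg.
  by apply: esum_ge0 => k _; rewrite lee_fin sqr_ge0.
have : (\sum_(r : 'I_N * 'I_N) 1%E =
    \sum_(x : 'I_L * ('I_M * 'I_M)) 1%E :> \bar R)%E.
  (* Double counting of the masses of the windows on the residue classes mod [N]: for fixed [r] the
     sum is 1 by Parseval, for fixed [(l, m)] it is the squared norm of [g l]. *)
  transitivity (\sum_(r : 'I_N * 'I_N) \sum_(x : 'I_L * ('I_M * 'I_M))
      \esum_(n in [set: int * int])
        (qabs (g x.1 (r.1%:Z - n.1 * N%:Z, r.2%:Z - n.2 * N%:Z)) ^+ 2)%:E)%E.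
    apply: eq_bigr => r _.
    rewrite -(parseval_delta (r.1%:Z, r.2%:Z) bg) esum_finType_prod; last first.
      by move=> a; rewrite lee_fin sqr_ge0.
    by apply: eq_bigr => -[l m] _; apply: eq_esum => n _; rewrite qabs_gabor.
  rewrite exchange_big; apply: eq_bigr => -[l m] _ /=.
  rewrite -(g1 l) (reindex_esum _ _ _ _ (divz_mod_bij N0)) esum_finType_prod//.
  by move=> a; rewrite lee_fin sqr_ge0.
rewrite !sumEFin => -[]; rewrite !sumr_const !card_prod !card_ord => /eqP.
by rewrite eqr_nat => /eqP; rewrite mulnn.
Qed.

(** * Finite Fourier analysis on a tile *)

(** [w ^+ n - 1] is [w - 1] times the sum, and quaternions have no zero divisors. *)
Lemma root_of_unity_sum (R : realType) (w : quat R) (n : nat) :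
  w ^+ n = 1 -> w <> 1 -> \sum_(i < n) w ^+ i = 0.
Proof.
move=> wn w1; have := subrX1 w n; rewrite wn subrr => /esym.
by move=> /quat_mulf_eq0[/eqP|//]; rewrite subr_eq0 => /eqP.
Qed.

(** A character of Z/M with values in the copy of the complex numbers generated by [u]. The shape
    agrees with the factors of [modulation], so that they match by unfolding. *)
Definition qchar (R : realType) (M : nat) (u : quat R) (m : nat) (k : int) :
  quat R := qexp u (2 * pi * (m%:R / M%:R) * k%:~R).

(** The bounds on [d] leave 0 as its only possible multiple of [M]; otherwise the terms are powers
    of a root of unity other than 1. *)
Lemma qchar_sum (R : realType) (M : nat) (u : quat R) (d : int) :
  imag_unit u -> (0 < M)%N -> - M%:Z < d -> d < M%:Z ->
  \sum_(x < M) qchar M u x d = if d == 0 then qreal M%:R else 0.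
Proof.
move=> hu M0 dM Md; have MR : M%:R != 0 :> R by rewrite pnatr_eq0 -lt0n.
pose w := qexp u (2 * pi * (d%:~R / M%:R)).
have -> : \sum_(x < M) qchar M u x d = \sum_(x < M) w ^+ x.
  apply: eq_bigr => x _; rewrite -qexpMn//; congr qexp.
  by rewrite -mulr_natr; field.
have [d0|d0] := eqVneq d 0.
  rewrite (eq_bigr (fun=> 1)); last first.
    by move=> x _; rewrite /w d0 mul0r mulr0 qexp0 expr1n.
  rewrite sumr_const card_ord.
  elim: (M) => [|n IH]; first by apply: quatP.
  by rewrite mulrS IH; apply: quatP; rewrite //= ?addr0// -natr1 addrC.
apply: root_of_unity_sum.
  rewrite -qexpMn// -[RHS](qexp_2pi d hu); congr qexp.
  by rewrite -mulr_natr; field.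
(* To see [w <> 1], compare real parts: that of [w] is cos 2y = 1 - 2 sin^2 y, and sin y is nonzero
   because 0 < |y| < pi. *)
have [u0 _] := hu; move=> /(congr1 (@qre R)) /=; rewrite u0.
set y := pi * (d%:~R / M%:R) : R.
have -> : 2 * pi * (d%:~R / M%:R) = y *+ 2 by rewrite mulr2n /y; ring.
have siny : sin y != 0.
  have posy (c : int) : 0 < c -> c < M%:Z -> sin (pi * (c%:~R / M%:R) : R) != 0.
    move=> c0 cM; rewrite gt_eqF// sin_gt0_pi//.
    rewrite mulr_gt0 ?pi_gt0 ?divr_gt0 ?ltr0z ?ltr0n//=.
    rewrite gtr_pMr ?pi_gt0// ltr_pdivrMr ?ltr0n// mul1r.
    by rewrite -[M%:R]/(M%:Z%:~R) ltr_int.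
  have [dlt|dgt|/eqP] := ltgtP d 0; last by rewrite (negPf d0).
    have := posy (- d); rewrite oppr_gt0 => /(_ dlt) H.
    have : sin (- y) != 0.
      by rewrite /y -mulrN -mulNr -intrN; apply: H; rewrite ltrNl.
    by rewrite sinN oppr_eq0.
  exact: posy.
rewrite cos_mulr2n cos2sin2 => H; move: siny; rewrite -sqrf_eq0 => /eqP; apply.
by move: H; rewrite mulr2n; nra.
Qed.

Lemma qchar_orthogonal (R : realType) (M : nat) (u : quat R) (m m' : 'I_M)
    (p : int) : imag_unit u -> (0 < M)%N ->
  \sum_(x < M) qconj (qchar M u m (p * M%:Z + x%:Z))
             * qchar M u m' (p * M%:Z + x%:Z)
  = if m == m' then qreal M%:R else 0.
Proof.
move=> hu M0; have MR : M%:R != 0 :> R by rewrite pnatr_eq0 -lt0n.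
have lm := ltn_ord m; have lm' := ltn_ord m'.
transitivity (\sum_(x < M) qchar M u x (m'%:Z - m%:Z)).
  apply: eq_bigr => x _; rewrite /qchar qexp_conj// -qexpD//.
  (* The offset [p * M] of the tile contributes a whole number of turns, inserted here as a factor
     1. *)
  rewrite -[RHS]mul1r -(qexp_2pi (p * (m'%:Z - m%:Z)) hu) -qexpD//.
  by congr qexp; rewrite !(intrD, intrM, intrN) -!pmulrn; field.
rewrite qchar_sum//; [|by lia..].
by rewrite subr_eq0 eqz_nat eq_sym.
Qed.

(** Points with equal quotient by [M] differ by less than [M], so [qchar_sum] applies to [k - k'].
    Without that hypothesis, distinct points congruent mod [M] would also give [M]. *)
Lemma qchar_dual (R : realType) (M : nat) (u : quat R) (k k' : int) :
  imag_unit u -> (0 < M)%N -> (k %/ M%:Z)%Z = (k' %/ M%:Z)%Z ->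
  \sum_(m < M) qchar M u m k * qconj (qchar M u m k')
  = if k == k' then qreal M%:R else 0.
Proof.
move=> hu M0 kk'; transitivity (\sum_(m < M) qchar M u m (k - k')).
  apply: eq_bigr => m _; rewrite /qchar qexp_conj// -qexpD//.
  by congr qexp; rewrite intrD intrN; ring.
have MZ : M%:Z != 0 by lia.
have MZ0 : 0 < M%:Z by lia.
have := divz_eq k M%:Z; have := divz_eq k' M%:Z; rewrite kk'.
have := modz_ge0 k MZ; have := ltz_pmod k MZ0.
have := modz_ge0 k' MZ; have := ltz_pmod k' MZ0.
move=> ? ? ? ? ? ?; rewrite qchar_sum//; [|by lia..].
by rewrite subr_eq0.
Qed.

(** * Tiles of side [M] and the waves supported on them *)

Definition tile (M : nat) (k : int * int) : int * int :=
  ((k.1 %/ M%:Z)%Z, (k.2 %/ M%:Z)%Z).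

Definition tile_point (M : nat) (p : int * int) (t : 'I_M * 'I_M) : int * int :=
  (p.1 * M%:Z + t.1%:Z, p.2 * M%:Z + t.2%:Z).

Lemma tile_point_inj (M : nat) (p : int * int) : injective (@tile_point M p).
Proof.
move=> [x y] [x' y'] [] /addrI[] xx /addrI[] yy.
by congr pair; apply: ord_inj.
Qed.

Lemma tile_pointP (M : nat) (k : int * int) : (0 < M)%N ->
  exists t : 'I_M * 'I_M, k = tile_point (tile M k) t.
Proof.
move=> M0; have MZ : M%:Z != 0 by lia.
have MZ0 : 0 < M%:Z by lia.
have rem (c : int) : exists x : 'I_M, c = (c %/ M%:Z)%Z * M%:Z + x%:Z.
  have lc : (`|(c %% M%:Z)%Z|%N < M)%N.
    by have := modz_ge0 c MZ; have := ltz_pmod c MZ0; lia.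
  exists (Ordinal lc) => /=.
  by have := modz_ge0 c MZ; have := divz_eq c M%:Z; lia.
have [x kx] := rem k.1; have [y ky] := rem k.2.
by exists (x, y); rewrite /tile_point /= -kx -ky -surjective_pairing.
Qed.

Lemma tile_tile_point (M : nat) (p : int * int) (t : 'I_M * 'I_M) :
  (0 < M)%N -> tile M (tile_point p t) = p.
Proof.
move=> M0; have MZ : M%:Z != 0 by lia.
have small (x : 'I_M) : (x%:Z %/ M%:Z)%Z = 0.
  by rewrite divz_nat divn_small.
by rewrite /tile /tile_point /= !divzMDl// !small !addr0 -surjective_pairing.
Qed.

(** The factor [M%:R^-1] normalises a function of modulus 1 on M^2 points. The two characters do not
    commute in general, and their order is that of [modulation]. *)
Definition tile_wave (R : realType) (M : nat) (p : int * int)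
    (m : 'I_M * 'I_M) (k : int * int) : quat R :=
  if tile M k == p
  then qchar M (qi R) m.1 k.1 * qchar M (qj R) m.2 k.2 * qreal M%:R^-1
  else 0.

Lemma tile_wave_support (R : realType) (M : nat) (p : int * int)
    (m : 'I_M * 'I_M) (k : int * int) : (0 < M)%N ->
  k \notin [seq tile_point p t | t <- enum {: 'I_M * 'I_M}] ->
  tile_wave R p m k = 0.
Proof.
move=> M0; rewrite /tile_wave; case: eqP => // kp /mapP[].
have [t kt] := tile_pointP k M0; exists t; first by rewrite mem_enum.
by rewrite -kp.
Qed.

Lemma uniq_tile (M : nat) (p : int * int) :
  uniq [seq tile_point p t | t <- enum {: 'I_M * 'I_M}].
Proof. by rewrite map_inj_uniq ?enum_uniq//; exact: tile_point_inj. Qed.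

Lemma l2_tile_wave (R : realType) (M : nat) (p : int * int)
    (m : 'I_M * 'I_M) : (0 < M)%N -> l2 (tile_wave R p m).
Proof.
move=> M0; apply: l2_finite_support (uniq_tile M p) _ => k.
exact: tile_wave_support.
Qed.

Lemma inner_tile_wave (R : realType) (M : nat) (p p' : int * int)
    (m m' : 'I_M * 'I_M) : (0 < M)%N ->
  inner (tile_wave R p m) (tile_wave R p' m') =
    ((p == p') && (m == m'))%:R.
Proof.
move=> M0; have MR : M%:R != 0 :> R by rewrite pnatr_eq0 -lt0n.
rewrite /inner; have [<-{p'}|pp'] := eqVneq p p'; last first.
  rewrite (@qsum_finite_support _ [::])// ?big_nil// => k _.
  rewrite /tile_wave; have [->|] := eqVneq (tile M k) p.
    by rewrite (negPf pp') mulr0.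
  by rewrite qconj0 mul0r.
rewrite (qsum_finite_support (uniq_tile M p)); last first.
  by move=> k /(tile_wave_support R m M0) ->; rewrite qconj0 mul0r.
rewrite big_map big_enum /=.
transitivity (\sum_(t : 'I_M * 'I_M) qreal M%:R^-1 *
    (qconj (qchar M (qj R) m.2 (p.2 * M%:Z + t.2%:Z)) *
     (qconj (qchar M (qi R) m.1 (p.1 * M%:Z + t.1%:Z)) *
       qchar M (qi R) m'.1 (p.1 * M%:Z + t.1%:Z)) *
     qchar M (qj R) m'.2 (p.2 * M%:Z + t.2%:Z)) * qreal M%:R^-1).
  apply: eq_bigr => t _; rewrite /tile_wave tile_tile_point// eqxx.
  by rewrite !qconjM qreal_conj !mulrA.
(* The characters in [qi] sit inside those in [qj], so the first coordinate is summed first. Its sum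
   is real and commutes with everything, which leaves an orthogonality sum in [qj] alone. *)
rewrite -mulr_suml -mulr_sumr -(pair_bigA _ (fun x y : 'I_M =>
    qconj (qchar M (qj R) m.2 (p.2 * M%:Z + y%:Z)) *
     (qconj (qchar M (qi R) m.1 (p.1 * M%:Z + x%:Z)) *
       qchar M (qi R) m'.1 (p.1 * M%:Z + x%:Z)) *
     qchar M (qj R) m'.2 (p.2 * M%:Z + y%:Z))) exchange_big /=.
under eq_bigr do rewrite -mulr_suml -mulr_sumr
  (qchar_orthogonal _ _ _ (imag_unit_qi R) M0).
rewrite -[m == m']/((m.1 == m'.1) && (m.2 == m'.2)).
have [_|_] /= := eqVneq m.1 m'.1; last first.
  by rewrite big1 ?mulr0 ?mul0r// => y _; rewrite mulr0 mul0r.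
under eq_bigr do rewrite -qrealC -mulrA.
rewrite -mulr_sumr qchar_orthogonal//; last exact: imag_unit_qj.
case: ifP => _; last by rewrite !mulr0 mul0r.
by rewrite -!qrealM mulrA mulVf// mul1r mulfV.
Qed.

(** Completeness on one tile: the coefficients are the inner products of the waves with the delta at
    [k0]. Here the characters in [qj] are the inner ones, so the second index of [m] is summed
    first. *)
Lemma tile_wave_delta (R : realType) (M : nat) (k k0 : int * int) :
  (0 < M)%N ->
  \sum_(m : 'I_M * 'I_M)
    tile_wave R (tile M k0) m k * qconj (tile_wave R (tile M k0) m k0) =
  (k == k0)%:R.
Proof.
move=> M0; have MR : M%:R != 0 :> R by rewrite pnatr_eq0 -lt0n.
rewrite /tile_wave eqxx.
have [kk0|kk0] := eqVneq (tile M k) (tile M k0); last first.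
  rewrite big1; last by move=> m _; rewrite mul0r.
  by case: eqP => // k_k0; rewrite k_k0 eqxx in kk0.
case: kk0 => kk1 kk2.
transitivity (\sum_(m : 'I_M * 'I_M) qreal M%:R^-1 *
    (qchar M (qi R) m.1 k.1 *
      (qchar M (qj R) m.2 k.2 * qconj (qchar M (qj R) m.2 k0.2)) *
     qconj (qchar M (qi R) m.1 k0.1)) * qreal M%:R^-1).
  apply: eq_bigr => m _; rewrite !qconjM qreal_conj -qrealC -!mulrA.
  by congr (_ * (_ * (_ * _))); rewrite qrealC -mulrA.
rewrite -mulr_suml -mulr_sumr -(pair_bigA _ (fun x y : 'I_M =>
    qchar M (qi R) x k.1 *
      (qchar M (qj R) y k.2 * qconj (qchar M (qj R) y k0.2)) *
     qconj (qchar M (qi R) x k0.1))) /=.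
under eq_bigr do rewrite -mulr_suml -mulr_sumr
  (qchar_dual (imag_unit_qj R) M0 kk2).
rewrite -[k == k0]/((k.1 == k0.1) && (k.2 == k0.2)) andbC.
have [_|_] /= := eqVneq k.2 k0.2; last first.
  by rewrite big1 ?mulr0 ?mul0r// => y _; rewrite mulr0 mul0r.
under eq_bigr do rewrite -qrealC -mulrA.
rewrite -mulr_sumr (qchar_dual (imag_unit_qi R) M0 kk1).
case: ifP => _; last by rewrite !mulr0 mul0r.
by rewrite -!qrealM mulrA mulVf// mul1r mulfV.
Qed.

(** * Sufficiency of the density condition *)

Lemma gabor_tile_wave (R : realType) (M r : nat) :
  (0 < M)%N -> (0 < r)%N ->
  exists (g : 'I_(r ^ 2) -> int * int -> quat R)
         (c : 'I_(r ^ 2) * (int * int) -> int * int),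
    [/\ injective c, forall p, exists a, c a = p, forall l, l2 (g l)
      & forall l m n,
        gabor (M := M) (r * M) g (l, m, n) = tile_wave R (c (l, n)) m].
Proof.
move=> M0 r0; have MZ : M%:Z != 0 by lia.
(* The windows enumerate the r^2 tiles of a square of side [r * M], with [l] written in base [r]. *)
pose origin (l : 'I_(r ^ 2)) : int * int := ((l %/ r)%:Z, (l %% r)%:Z).
pose g l k : quat R := if tile M k == origin l then qreal M%:R^-1 else 0.
(* The tile on which window [l] lands after translation by [n]: moving by [r * M] points moves the
   tile index by [r]. Bijectivity is division by [r], with [n] negated to fit [divz_mod_bij]. *)
pose c (a : 'I_(r ^ 2) * (int * int)) : int * int :=
  ((origin a.1).1 + a.2.1 * r%:Z, (origin a.1).2 + a.2.2 * r%:Z).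
have hq (l : 'I_(r ^ 2)) : (l %/ r < r)%N by rewrite ltn_divLR// mulnn.
have hm (l : 'I_(r ^ 2)) : (l %% r < r)%N by rewrite ltn_mod.
exists g, c; split.
- move=> [l n] [l' n'] ccE.
  have [_ inj _] := divz_mod_bij r0.
  have := inj (Ordinal (hq l), Ordinal (hm l), (- n.1, - n.2))
    (Ordinal (hq l'), Ordinal (hm l'), (- n'.1, - n'.2))
    (in_setT _) (in_setT _).
  case: ccE => /= E1 E2; rewrite !mulNr !opprK E1 E2 => /(_ erefl)[lq lm n1 n2].
  congr pair; first by apply: ord_inj; rewrite (divn_eq l r) lq lm -divn_eq.
  rewrite [n]surjective_pairing [n']surjective_pairing.
  by rewrite -[n.1]opprK n1 -[n.2]opprK n2 !opprK.
- move=> p; have [_ _ surj] := divz_mod_bij r0.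
  have [[[x y] n] _ <-] := surj p I.
  have lxy : (x * r + y < r ^ 2)%N.
    by have := ltn_ord x; have := ltn_ord y; rewrite -mulnn; nia.
  exists (Ordinal lxy, (- n.1, - n.2)); rewrite /c /origin /= !mulNr.
  by rewrite divnMDl// divn_small// addn0 modnMDl modn_small.
- move=> l; pose s := [seq tile_point (origin l) t | t <- enum {: 'I_M * 'I_M}].
  apply: (@l2_finite_support _ s); first exact: uniq_tile.
  move=> k; rewrite /g; case: eqP => // kp /mapP[].
  have [t kt] := tile_pointP k M0; exists t; first by rewrite mem_enum.
  by rewrite -kp.
- move=> l m n; apply/funext => k; rewrite /gabor /modulation /translation.
  (* Modulation acts after translation, so its characters are evaluated at [k] itself and no extra
     phase appears. *)
  have -> : tile_wave R (c (l, n)) m k = qchar M (qi R) m.1 k.1 *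
      g l (k.1 - n.1 * (r * M)%N%:Z, k.2 - n.2 * (r * M)%N%:Z) *
      qchar M (qj R) m.2 k.2; last by [].
  have shift (a b : int) : ((a - b * (r * M)%N%:Z) %/ M%:Z)%Z =
      (a %/ M%:Z)%Z - b * r%:Z.
    by rewrite addrC PoszM mulrA -mulNr divzMDl// addrC.
  rewrite /g /tile_wave /tile /= !shift.
  rewrite -![(_, _) == _]/((_ == _) && (_ == _)) /= !subr_eq.
  case: ifP => _; last by rewrite mulr0 mul0r.
  by rewrite -mulrA -qrealC mulrA.
Qed.

Lemma gabor_basis_exists (R : realType) (M r : nat) : (0 < M)%N -> (0 < r)%N ->
  exists g : 'I_(r ^ 2) -> int * int -> quat R,
    (forall l, l2 (g l)) /\ orthonormal_basis (gabor (M := M) (r * M) g).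
Proof.
move=> M0 r0; have [g [c [c_inj c_surj lg gE]]] := gabor_tile_wave R M0 r0.
exists g; split=> //; split.
- by move=> [[l m] n]; rewrite gE; exact: l2_tile_wave.
- move=> [[l m] n] [[l' m'] n']; rewrite !gE inner_tile_wave// (inj_eq c_inj).
  by congr (_ %:R); rewrite !xpair_eqE andbAC.
(* Surjectivity of [c] puts all waves of the tile containing [k0] into the Gabor system, and these
   expand the delta at [k0]. *)
apply: dense_of_delta => k0; have [[l n] cp] := c_surj (tile M k0).
exists [seq ((l, m, n), qconj (tile_wave R (tile M k0) m k0)) |
         m <- enum {: 'I_M * 'I_M}] => k.
rewrite /right_comb big_map big_enum -(tile_wave_delta R k k0 M0).
by apply: eq_bigr => m _; rewrite gE cp.
Qed.

Theorem theorem6 (R : realType) (L M N : nat)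
    (hL : (0 < L)%N) (hM : (0 < M)%N) (hN : (0 < N)%N) :
  (exists g : 'I_L -> int * int -> quat R,
      (forall l, l2 (g l)) /\ orthonormal_basis (gabor (M := M) N g))
  <-> (N ^ 2 = L * M ^ 2)%N.
Proof.
split=> [[g [lg bg]]|NLM]; first exact: gabor_card hM hN lg bg.
(* Divisibility of the squares gives [N = r * M]; cancelling [M ^ 2] then gives [L = r ^ 2]. *)
have : (M ^ 2 %| N ^ 2)%N by rewrite NLM dvdn_mull.
rewrite dvdn_pexp2r// => /dvdnP[r NrM].
have -> : L = (r ^ 2)%N.
  apply/eqP; rewrite -(@eqn_pmul2r (M ^ 2)) ?expn_gt0 ?hM//.
  by rewrite -NLM NrM expnMn.
rewrite NrM; apply: gabor_basis_exists => //.
by move: hN; rewrite NrM muln_gt0 => /andP[].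
Qed.
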